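(* Let $L$ be a locale and let $S\neq L$ be an open dense sublocale of $L$, with supplement $S^{\#}=L\smallsetminus S$. (1) If $S^{\#}$ is $^{*}$remote from $S$, then $S^{\#}$ is maximal nowhere dense in $L$. (2) If $S^{\#}$ is homogeneous maximal nowhere dense in $L$, then every remote sublocale of the locale $S^{\#}$ is $^{*}$remote from $S$.
   Context: $\mathcal{S}(L)$ is the set of sublocales of $L$ ordered by inclusion; $\mathsf{O}=\{1\}$ is the void sublocale. $\overline{S}$ is the closure of $S$ in $L$. $S^{\#}=L\smallsetminus S$ is the supplement of $S$: the smallest $T\in\mathcal{S}(L)$ with $S\vee T=L$. A sublocale $N$ of $L$ is nowhere dense if $N\cap\mathfrak{B}L=\mathsf{O}$, where $\mathfrak{B}L=\{x\to 0:x\in L\}$. For $S\in\mathcal{S}(L)$, ''$N$ is nowhere dense in $S$'' ($S$-nowhere dense) means $N\subseteq S$ and $N$ is a nowhere dense sublocale of the locale $S$. A nowhere dense sublocale $N$ of $L$ is maximal nowhere dense if there is no nowhere dense sublocale $K$ of $L$ such that $N$ is nowhere dense in $K$. A regular-closed sublocale of a locale is the closure of some open sublocale. A closed nowhere dense sublocale $N$ of $L$ is homogeneous maximal nowhere dense if each non-void regular-closed sublocale of the locale $N$ is maximal nowhere dense in $L$. A sublocale $T$ of a locale $M$ is a remote sublocale of $M$ if $T\cap N=\mathsf{O}$ for every nowhere dense sublocale $N$ of $M$. For a dense sublocale $S$ of $L$, $T\in\mathcal{S}(L)$ is remote from $S$ if $T\cap\overline{N}=\mathsf{O}$ for every $S$-nowhere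 dense $N$ (closure in $L$), and $^{*}$remote from $S$ if in addition $T\subseteq L\smallsetminus S$. *)

(* Defs.v *)
From HB Require Import structures.
From mathcomp Require Import all_boot all_order.
From mathcomp Require Import boolp classical_sets.

Set Implicit Arguments.
Unset Strict Implicit.
Unset Printing Implicit Defensive.

Import Order.TTheory.
Local Open Scope order_scope.
Local Open Scope classical_set_scope.

(* Lets a structure coercing to a set be applied as a predicate. *)
Identity Coercion set_to_pred : set >-> Funclass.

(* A locale (frame): a complete lattice in which binary meets distribute over
   arbitrary joins.  Arbitrary meets and the Heyting arrow are derived below. *)
HB.mixin Record TBLattice_isLocale d T of Order.TBLattice d T := {
  lsup : set T -> T;
  lsup_supremums : forall A : set T, supremums A (lsup A);
  meet_lsup : forall (a : T) (A : set T),
    Order.meet a (lsup A) = lsup [set Order.meet a x | x in A]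
}.

#[short(type="localeType")]
HB.structure Definition Locale d :=
  { T of Order.TBLattice d T & TBLattice_isLocale d T }.

Section LocaleTheory.
Context {d : Order.disp_t} {L : localeType d}.
Implicit Types (a b c x y : L) (A : set L).

Definition linf A : L := lsup (lbound A).

Definition imp a b : L := lsup [set c | Order.meet c a <= b].

Lemma lsup_le A y : (forall x, A x -> x <= y) -> lsup A <= y.
Proof. by move=> h; apply: (lsup_supremums A).2. Qed.

Lemma lsup_ub A x : A x -> x <= lsup A.
Proof. exact: (lsup_supremums A).1. Qed.

Lemma linf_lb A x : A x -> linf A <= x.
Proof. by move=> Ax; apply: lsup_le => y; apply. Qed.

Lemma le_linf A y : (forall x, A x -> y <= x) -> y <= linf A.
Proof. by move=> h; apply: lsup_ub. Qed.

Lemma le_imp c a b : (c <= imp a b) = (Order.meet c a <= b).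
Proof.
apply/idP/idP => [h|h]; last exact: lsup_ub.
apply: (@le_trans _ _ (Order.meet (imp a b) a)); first exact: leI2.
rewrite meetC meet_lsup; apply: lsup_le => _ [x /= xab <-].
by rewrite meetC.
Qed.

Lemma imp_mp a b : Order.meet (imp a b) a <= b.
Proof. by rewrite -le_imp. Qed.

Lemma imp_anti a b c : a <= b -> imp b c <= imp a c.
Proof.
move=> ab; rewrite le_imp; apply: le_trans (imp_mp b c).
exact: leI2.
Qed.

Lemma impA a b c : imp a (imp b c) = imp (Order.meet a b) c.
Proof.
apply/eqP; rewrite eq_le; apply/andP; split.
  by rewrite le_imp meetA -!le_imp.
by rewrite !le_imp -meetA -le_imp.
Qed.

Lemma imp_linf a A : imp a (linf A) = linf [set imp a x | x in A].
Proof.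
apply/eqP; rewrite eq_le; apply/andP; split.
  apply: le_linf => _ [x Ax <-]; rewrite le_imp.
  exact: le_trans (imp_mp _ _) (linf_lb Ax).
rewrite le_imp; apply: le_linf => x Ax; rewrite -le_imp.
by apply: linf_lb; exists x.
Qed.

End LocaleTheory.

Record sublocale {d : Order.disp_t} (L : localeType d) := Sublocale {
  carrier :> set L;
  sub_linf : forall A : set L, A `<=` carrier -> carrier (linf A);
  sub_imp : forall x s : L, carrier s -> carrier (imp x s)
}.

(* The reflection of L onto a sublocale S: the least element of S above x. *)
Definition nucleus {d : Order.disp_t} {L : localeType d} (S : sublocale L)
  (x : L) : L := linf [set s | S s /\ x <= s].

Section Nucleus.
Context {d : Order.disp_t} {L : localeType d} (S : sublocale L).
Implicit Types (x y s : L).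

Lemma nucleus_in x : S (nucleus S x).
Proof. by apply: sub_linf => s []. Qed.

Lemma le_nucleus x : x <= nucleus S x.
Proof. by apply: le_linf => s []. Qed.

Lemma nucleus_le x s : S s -> (nucleus S x <= s) = (x <= s).
Proof.
move=> Ss; apply/idP/idP; first exact: le_trans (le_nucleus x).
by move=> xs; apply: linf_lb.
Qed.

Lemma imp_nucleus x s : S s -> imp (nucleus S x) s = imp x s.
Proof.
move=> Ss; apply/eqP; rewrite eq_le imp_anti ?le_nucleus //=.
rewrite le_imp meetC -le_imp nucleus_le ?le_imp; last exact: sub_imp.
by rewrite meetC imp_mp.
Qed.

Lemma sub_top : S \top.
Proof.
suff -> : \top = linf (set0 : set L) by apply: sub_linf => ? [].
by apply/eqP; rewrite eq_le lex1 andbT; apply: le_linf.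
Qed.

Lemma sub_meet x y : S x -> S y -> S (Order.meet x y).
Proof.
move=> Sx Sy; suff -> : Order.meet x y = linf [set x; y].
  by apply: sub_linf => z [->|->].
apply/eqP; rewrite eq_le; apply/andP; split.
  by apply: le_linf => z [->|->]; rewrite ?leIl ?leIr.
by rewrite lexI; apply/andP; split; apply: linf_lb; [left|right].
Qed.

End Nucleus.

(* A sublocale, as a locale in its own right: order, meets and Heyting arrow
   are those of L (incl_linf, incl_imp), joins are reflected joins of L. *)
Definition as_locale {d : Order.disp_t} {L : localeType d} (S : sublocale L)
  : Type := {x : L | x \in (S : set L)}.

Section AsLocale.
Context {d : Order.disp_t} {L : localeType d} (S : sublocale L).

HB.instance Definition _ := SubChoice.on (as_locale S).
HB.instance Definition _ := [SubChoice_isSubPOrder of as_locale S by <: with d].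

Implicit Types (u v w : as_locale S) (x : L).

Definition to_sub x (Sx : S x) : as_locale S := exist _ x (mem_set Sx).

Definition incl u : L := val u.

Lemma le_incl u v : (incl u <= incl v) = (u <= v).
Proof. by []. Qed.

Lemma incl_inj : injective incl.
Proof. exact: val_inj. Qed.

Lemma incl_in u : S (incl u).
Proof. exact: set_mem (valP u). Qed.

Definition sub_meet_op u v := to_sub (sub_meet (incl_in u) (incl_in v)).
Definition sub_join_op u v :=
  to_sub (nucleus_in S (Order.join (incl u) (incl v))).

Lemma sub_meet_opP u v w : (u <= sub_meet_op v w) = (u <= v) && (u <= w).
Proof. by rewrite -!le_incl lexI. Qed.

Lemma sub_join_opP u v w : (sub_join_op u v <= w) = (u <= w) && (v <= w).
Proof. by rewrite -!le_incl nucleus_le ?leUx //; exact: incl_in. Qed.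

HB.instance Definition _ := Order.POrder_MeetJoin_isLattice.Build d
  (as_locale S) sub_meet_opP sub_join_opP.

Lemma sub_bot_le u : to_sub (nucleus_in S \bot) <= u.
Proof. by rewrite -le_incl nucleus_le ?le0x //; exact: incl_in. Qed.

Lemma le_sub_top u : u <= to_sub (sub_top S).
Proof. by rewrite -le_incl lex1. Qed.

HB.instance Definition _ := Order.hasBottom.Build d (as_locale S) sub_bot_le.
HB.instance Definition _ := Order.hasTop.Build d (as_locale S) le_sub_top.

Definition sub_lsup (A : set (as_locale S)) : as_locale S :=
  to_sub (nucleus_in S (lsup [set incl u | u in A])).

Lemma sub_lsup_supremums A : supremums A (sub_lsup A).
Proof.
split=> u.
  move=> Au; rewrite -le_incl; apply: le_trans (le_nucleus _ _).
  by apply: lsup_ub; exists u.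
move=> hu; rewrite -le_incl nucleus_le; last exact: incl_in.
by apply: lsup_le => _ [v Av <-]; rewrite le_incl; apply: hu.
Qed.

Lemma sub_meet_lsup u A :
  Order.meet u (sub_lsup A) = sub_lsup [set Order.meet u v | v in A].
Proof.
apply/eqP; rewrite eq_le; apply/andP; split; last first.
  apply: (sub_lsup_supremums _).2 => _ [v Av <-]; apply: leI2 => //.
  exact: (sub_lsup_supremums A).1.
rewrite -le_incl meetC -le_imp nucleus_le; last first.
  by apply: sub_imp; exact: incl_in.
apply: lsup_le => _ [v Av <-]; rewrite le_imp.
apply: le_trans (le_nucleus _ _); apply: lsup_ub.
exists (Order.meet u v); first by exists v.
by rewrite meetC.
Qed.

HB.instance Definition _ := TBLattice_isLocale.Build d (as_locale S)
  sub_lsup_supremums sub_meet_lsup.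

Lemma incl_linf (A : set (as_locale S)) :
  incl (linf A) = linf [set incl u | u in A].
Proof.
apply/eqP; rewrite eq_le; apply/andP; split.
  by apply: le_linf => _ [u Au <-]; rewrite le_incl; exact: linf_lb.
have Si : S (linf [set incl u | u in A]).
  by apply: sub_linf => _ [u _ <-]; exact: incl_in.
rewrite -[X in X <= _]/(incl (to_sub Si)) le_incl.
by apply: le_linf => u Au; rewrite -le_incl; apply: linf_lb; exists u.
Qed.

Lemma incl_imp u v : incl (imp u v) = imp (incl u) (incl v).
Proof.
apply/eqP; rewrite eq_le; apply/andP; split.
  by rewrite le_imp -[X in X <= _]/(incl (Order.meet (imp u v) u))
    le_incl imp_mp.
have Si : S (imp (incl u) (incl v)) by apply: sub_imp; exact: incl_in.
rewrite -[X in X <= _]/(incl (to_sub Si)) le_incl le_imp -le_incl.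
exact: imp_mp.
Qed.

End AsLocale.

Section Transfer.
Context {d : Order.disp_t} {L : localeType d} (S : sublocale L).

Definition restrict_set (T : sublocale L) : set (as_locale S) :=
  [set u | T (incl u)].

Lemma restrict_linf T A :
  A `<=` restrict_set T -> restrict_set T (linf A).
Proof.
move=> AT; rewrite /restrict_set /mkset incl_linf; apply: sub_linf => _ [u Au <-].
exact: AT.
Qed.

Lemma restrict_imp T u v : restrict_set T v -> restrict_set T (imp u v).
Proof. by move=> Tv; rewrite /restrict_set /mkset incl_imp; exact: sub_imp. Qed.

(* T meet S, as a sublocale of the locale S *)
Definition restrict (T : sublocale L) : sublocale (as_locale S) :=
  Sublocale (@restrict_linf T) (@restrict_imp T).

Definition embed_set (T : sublocale (as_locale S)) : set L :=
  [set incl u | u in T].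

Lemma embed_linf T A : A `<=` embed_set T -> embed_set T (linf A).
Proof.
move=> AT; exists (linf [set u | T u /\ A (incl u)]).
  by apply: sub_linf => u [].
rewrite incl_linf; congr linf; apply/seteqP; split=> [_ [u [_ Au] <-] //|x Ax].
by have [u Tu ux] := AT _ Ax; exists u => //; split=> //; rewrite /mkset ux.
Qed.

Lemma embed_imp T x s : embed_set T s -> embed_set T (imp x s).
Proof.
case=> u Tu <-; exists (imp (to_sub (nucleus_in S x)) u); first exact: sub_imp.
by rewrite incl_imp imp_nucleus //; exact: incl_in.
Qed.

(* A sublocale of the locale S, as a sublocale of L *)
Definition embed (T : sublocale (as_locale S)) : sublocale L :=
  Sublocale (@embed_linf T) (@embed_imp T).

End Transfer.

Section Sublocales.
Context {d : Order.disp_t} {L : localeType d}.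
Implicit Types (a : L) (S T N K R : sublocale L).

Definition sub_void : set L := [set \top].

Lemma bigmeet_linf (F : set (sublocale L)) A :
  A `<=` \bigcap_(T in F) T -> (\bigcap_(T in F) T) (linf A).
Proof. by move=> AF T FT; apply: sub_linf => x Ax; exact: AF. Qed.

Lemma bigmeet_imp (F : set (sublocale L)) x s :
  (\bigcap_(T in F) T) s -> (\bigcap_(T in F) T) (imp x s).
Proof. by move=> Fs T FT; apply: sub_imp; exact: Fs. Qed.

Definition bigmeet (F : set (sublocale L)) : sublocale L :=
  Sublocale (@bigmeet_linf F) (@bigmeet_imp F).

(* The binary join of the lattice of all sublocales *)
Definition sub_join S T : sublocale L :=
  bigmeet [set U : sublocale L | S `<=` U /\ T `<=` U].

(* The smallest T whose join with S is L; see supplementP *)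
Definition supplement S : sublocale L :=
  bigmeet [set T : sublocale L | sub_join S T = [set: L] :> set L].

Lemma closed_linf a A :
  A `<=` [set x | a <= x] -> [set x | a <= x] (linf A).
Proof. exact: le_linf. Qed.

Lemma closed_imp a x s : [set x | a <= x] s -> [set x | a <= x] (imp x s).
Proof. by move=> /= h; rewrite le_imp (le_trans (leIl _ _)). Qed.

Definition closed_sub a : sublocale L :=
  Sublocale (@closed_linf a) (@closed_imp a).

Lemma open_linf a A :
  A `<=` range (imp a) -> range (imp a) (linf A).
Proof.
move=> Aa; exists (linf A) => //; rewrite imp_linf; congr linf.
have fixA x : A x -> imp a x = x by move=> /Aa [y _ <-]; rewrite impA meetxx.
apply/seteqP; split=> [_ [x Ax <-]|x Ax]; first by rewrite fixA.
by exists x => //; rewrite fixA.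
Qed.

Lemma open_imp a x s : range (imp a) s -> range (imp a) (imp x s).
Proof. by case=> y _ <-; exists (imp x y) => //; rewrite !impA meetC. Qed.

Definition open_sub a : sublocale L := Sublocale (@open_linf a) (@open_imp a).

Definition is_closed S : Prop := exists a, S = closed_sub a :> set L.

Definition is_open S : Prop := exists a, S = open_sub a :> set L.

(* The smallest closed sublocale containing S; see closureP *)
Definition closure S : sublocale L := closed_sub (linf S).

Definition is_dense S : Prop := closure S = [set: L] :> set L.

Definition booleanization : set L := [set imp x \bot | x in [set: L]].

Definition nowhere_dense N : Prop := N `&` booleanization = sub_void.

Definition regular_closed R : Prop :=
  exists2 U : sublocale L, is_open U & R = closure U :> set L.

Definition remote T : Prop :=
  forall N, nowhere_dense N -> T `&` N = sub_void.

End Sublocales.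

Section RelativeNotions.
Context {d : Order.disp_t} {L : localeType d}.
Implicit Types (S T N K : sublocale L).

Definition nowhere_dense_in N S : Prop :=
  N `<=` S /\ nowhere_dense (restrict S N).

Definition maximal_nowhere_dense N : Prop :=
  nowhere_dense N /\
  ~ (exists K, nowhere_dense K /\ nowhere_dense_in N K).

Definition homogeneous_maximal_nowhere_dense N : Prop :=
  [/\ is_closed N, nowhere_dense N &
      forall R : sublocale (as_locale N),
        regular_closed R -> R <> sub_void :> set (as_locale N) ->
        maximal_nowhere_dense (embed R)].

(* Used for dense S only *)
Definition remote_from T S : Prop :=
  forall N, nowhere_dense_in N S -> T `&` closure N = sub_void.

Definition star_remote_from T S : Prop :=
  remote_from T S /\ T `<=` supplement S.

End RelativeNotions.

Section Characterizations.
Context {d : Order.disp_t} {L : localeType d}.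
Implicit Types (S T : sublocale L).

Lemma closureP S :
  [/\ is_closed (closure S), S `<=` closure S &
      forall C : sublocale L, is_closed C -> S `<=` C -> closure S `<=` C].
Proof.
split; [by exists (linf S) | by move=> x Sx; exact: linf_lb |].
move=> C [a Ca]; rewrite Ca => SC x Sx.
by apply: (@le_trans _ _ (linf S)) => //; apply: le_linf => s /SC.
Qed.

Lemma sub_joinE S T :
  sub_join S T = [set Order.meet s t | s in S & t in T] :> set L.
Proof.
pose J : set L := [set Order.meet s t | s in S & t in T].
have Jlinf A : A `<=` J -> J (linf A).
  move=> AJ; exists (nucleus S (linf A)); first exact: nucleus_in.
  exists (nucleus T (linf A)); first exact: nucleus_in.
  apply/eqP; rewrite eq_le lexI !le_nucleus !andbT.
  apply: le_linf => a Aa; have [s Ss [t Tt sta]] := AJ _ Aa.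
  have := linf_lb Aa; rewrite -sta lexI => /andP[As At].
  by apply: leI2; rewrite nucleus_le.
have Jimp x y : J y -> J (imp x y).
  case=> s Ss [t Tt <-].
  exists (imp x s); first exact: sub_imp.
  exists (imp x t); first exact: sub_imp.
  apply/eqP; rewrite eq_le; apply/andP; split.
    rewrite le_imp lexI; apply/andP; split.
      by apply: le_trans (imp_mp x s); apply: leI2 => //; exact: leIl.
    by apply: le_trans (imp_mp x t); apply: leI2 => //; exact: leIr.
  rewrite lexI !le_imp; apply/andP; split.
    exact: le_trans (imp_mp _ _) (leIl _ _).
  exact: le_trans (imp_mp _ _) (leIr _ _).
apply/seteqP; split=> [x|_ [s Ss [t Tt <-]] U [SU TU]]; last first.
  by apply: sub_meet; [exact: SU | exact: TU].
move=> /(_ (Sublocale Jlinf Jimp)); apply; split=> y ?.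
  by exists y => //; exists \top; [exact: sub_top | rewrite meetx1].
by exists \top; [exact: sub_top | exists y => //; rewrite meet1x].
Qed.

Lemma supplementP S :
  sub_join S (supplement S) = [set: L] :> set L /\
  forall T, sub_join S T = [set: L] :> set L -> supplement S `<=` T.
Proof.
split; last by move=> T ST x; apply.
rewrite sub_joinE; apply/seteqP; split=> // x _.
exists (nucleus S x); first exact: nucleus_in.
exists (imp (nucleus S x) x); last first.
  apply/eqP; rewrite eq_le meetC imp_mp /= lexI le_nucleus andbT.
  by rewrite le_imp leIl.
move=> T ST; have {}ST : sub_join S T = [set: L] :> set L := ST.
have : [set: L] x by [].
rewrite -ST sub_joinE => -[s Ss [t Tt stx]].
have xs : x <= s by rewrite -stx leIl.
suff -> : imp (nucleus S x) x = imp (nucleus S x) t by exact: sub_imp.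
apply/eqP; rewrite eq_le !le_imp; apply/andP; split.
  by apply: le_trans (imp_mp _ _) _; rewrite -stx leIr.
rewrite -[X in _ <= X]stx lexI; apply/andP; split; last exact: imp_mp.
by apply: le_trans (leIr _ _) _; rewrite nucleus_le.
Qed.

End Characterizations.

(* Main.v *)
(* Write S as the open sublocale of a dense element a, so that its supplement
   is the closed sublocale of a.  Everything is computed with bottoms: N is
   nowhere dense in S iff the Heyting arrow from the bottom of N to the bottom
   of S is the bottom of S.
   (1) If the supplement is nowhere dense in a nowhere dense K with bottom k,
   then a -> k = k, so k lies in S; hence the meet of K and S is nowhere dense
   in S while its closure contains a, and remoteness forces a = 1.
   (2) Let N be nowhere dense in S, with bottom n.  It suffices that
   n -> a = a.  Otherwise r = (n -> a) -> a is the bottom of a non-void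
   regular-closed sublocale R of the supplement; as r -> n <= a -> n = n, R is
   nowhere dense in the closed sublocale of n, which is nowhere dense in L,
   against the maximality of R. *)
From mathcomp Require Import all_boot all_order.
From mathcomp Require Import boolp classical_sets.
Require Import Defs.

Set Implicit Arguments.
Unset Strict Implicit.
Unset Printing Implicit Defensive.

Import Order.TTheory.
Local Open Scope order_scope.
Local Open Scope classical_set_scope.

Section HeytingArrow.
Context {d : Order.disp_t} {L : localeType d}.
Implicit Types (a b x : L) (A : set L) (S N : sublocale L).

Lemma imp_eq_top a b : (imp a b = \top) <-> a <= b.
Proof.
rewrite -[a in a <= b]meet1x -le_imp; split=> [-> //|h].
by apply: le_anti; rewrite lex1.
Qed.

Lemma le_imp_self a b : b <= imp a b.
Proof. by rewrite le_imp leIl. Qed.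

Lemma imp_eq_cod a b : (forall c, Order.meet c a <= b -> c <= b) ->
  imp a b = b.
Proof.
move=> h; apply: le_anti; rewrite le_imp_self andbT.
exact/h/imp_mp.
Qed.

Lemma linf_min A x : A x -> (forall y, A y -> x <= y) -> linf A = x.
Proof. by move=> Ax h; apply: le_anti; rewrite linf_lb //= le_linf. Qed.

Lemma linf_in S : S (linf S).
Proof. exact: sub_linf. Qed.

Lemma linf_closed_sub a : linf (closed_sub a) = a.
Proof. by apply: linf_min => //=. Qed.

Lemma linf_open_sub a : linf (open_sub a) = imp a \bot.
Proof.
apply: linf_min; first by exists \bot.
move=> _ [x _ <-]; rewrite le_imp; exact: le_trans (imp_mp _ _) (le0x _).
Qed.

Lemma dense_linf S : is_dense S -> linf S = \bot.
Proof.
move=> dS; apply: le_anti; rewrite le0x andbT.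
by have : closure S \bot by rewrite dS.
Qed.

(* With n the bottom of N, the double negation of n equals (n -> 0) -> n, so
   it lies in N. *)
Lemma nowhere_dense_linf N :
  nowhere_dense N <-> imp (linf N) \bot = \bot.
Proof.
set n := linf N; split=> [ndN|n0].
  have nnE : imp (imp n \bot) n = imp (imp n \bot) \bot.
    apply: le_anti; apply/andP; split; last first.
      rewrite le_imp; exact: le_trans (imp_mp _ _) (le0x _).
    rewrite le_imp; apply: le_trans (imp_mp n \bot).
    by rewrite lexI leIr imp_mp.
  have : (N `&` booleanization) (imp (imp n \bot) \bot).
    by split; [rewrite -nnE; apply: sub_imp; exact: linf_in | eexists].
  rewrite ndN => /imp_eq_top h; apply: le_anti; by rewrite h le0x.
apply/seteqP; split=> [x [Nx [y _ xE]]|_ ->]; last first.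
  split; first exact: sub_top.
  by exists \bot => //; apply/imp_eq_top.
rewrite -xE; apply/imp_eq_top; rewrite -n0 le_imp meetC -le_imp xE.
exact: linf_lb.
Qed.

End HeytingArrow.

Section RelativeNowhereDense.
Context {d : Order.disp_t} {L : localeType d}.
Implicit Types (a : L) (S N : sublocale L).

Lemma incl_bot S : incl (\bot : as_locale S) = linf S.
Proof.
apply: le_anti; rewrite (linf_lb (incl_in _)) andbT.
by rewrite -[X in _ <= X]/(incl (to_sub (linf_in S))) le_incl le0x.
Qed.

(** The inclusion of the locale S into L preserves meets and arrows and sends the bottom to
    [linf S], so the density criterion for bottoms can be read in L. *)
Lemma nowhere_dense_restrict S N :
  nowhere_dense (restrict S N) <->
  imp (linf (S `&` N)) (linf S) = linf S.
Proof.
have linfE : incl (linf (restrict S N)) = linf (S `&` N).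
  rewrite incl_linf; congr linf.
  apply/seteqP; split=> [_ [u Nu <-]|x [Sx Nx]].
    by split; [exact: incl_in | exact: Nu].
  by exists (to_sub Sx).
rewrite nowhere_dense_linf; split=> [/(congr1 (@incl _ _ S))|h].
  by rewrite incl_imp linfE incl_bot.
by apply: incl_inj; rewrite incl_imp linfE incl_bot.
Qed.

Lemma nowhere_dense_in_linf S N :
  nowhere_dense_in N S <->
  N `<=` S /\ imp (linf N) (linf S) = linf S.
Proof.
by split=> -[NS h]; split=> //; move: h; rewrite nowhere_dense_restrict setIidr.
Qed.

Lemma supplement_open a S : S = open_sub a :> set L ->
  supplement S = closed_sub a :> set L.
Proof.
move=> SE; have [_ min] := supplementP S.
apply/seteqP; split.
  apply: min; rewrite sub_joinE; apply/seteqP; split=> // x _.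
  (* By distributivity, x is the meet of a -> x and the join of a and x. *)
  exists (imp a x); first by rewrite SE; exists x.
  exists (Order.join a x); first exact: leUl.
  apply: le_anti; rewrite lexI le_imp_self leUr andbT.
  by rewrite meetC -le_imp leUx !le_imp meetC imp_mp leIl.
move=> x /= ax T ST; have : [set: L] x by [].
have {}ST : sub_join S T = [set: L] :> set L by [].
rewrite -ST sub_joinE => -[s Ss [t Tt stx]].
(* If a <= a -> y then a <= y, so the only member of S above a is the top; hence x = t lies in T. *)
have as_ : a <= s by apply: le_trans ax _; rewrite -stx leIl.
move: Ss as_ stx; rewrite SE => -[y _ <-].
by rewrite le_imp meetxx => /imp_eq_top -> <-; rewrite meet1x.
Qed.

End RelativeNowhereDense.

Section OpenDense.
Context {d : Order.disp_t} {L : localeType d} (S : sublocale L).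
Hypotheses (S_open : is_open S) (S_dense : is_dense S).

Lemma star_remote_supplement_maximal : S <> [set: L] :> set L ->
  star_remote_from (supplement S) S -> maximal_nowhere_dense (supplement S).
Proof.
have [a SE] := S_open; have ME := supplement_open SE.
(* The bottom of S is the pseudocomplement of a, so density of S makes a dense. *)
have a0 : imp a \bot = \bot by rewrite -linf_open_sub -SE dense_linf.
move=> S_neq_L [rem _]; split.
  by apply/nowhere_dense_linf; rewrite ME linf_closed_sub.
move=> [K [/nowhere_dense_linf ndK /nowhere_dense_in_linf]].
rewrite ME linf_closed_sub => -[MK akk].
set k := linf K in ndK akk.
have ka : k <= a by apply/linf_lb/MK/lexx.
have Sk : S k by rewrite SE; exists k.
pose N := bigmeet [set S; K].
have Nk : N k by move=> _ [->|->] //; exact: linf_in.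
have linfN : linf N = k.
  by apply: linf_min => // y /(_ K (or_intror erefl)) /linf_lb.
have : nowhere_dense_in N S.
  apply/nowhere_dense_in_linf; split; first by move=> x; apply; left.
  by rewrite linfN dense_linf.
move=> /rem; rewrite ME => /seteqP[h _].
(* As k <= a, the element a lies in both the supplement and the closure of N. *)
have : [set \top] a by apply: h; split; rewrite /= ?linfN.
move=> /= a1; apply: S_neq_L; rewrite SE a1; apply/seteqP; split=> // x _.
exists x => //; apply: imp_eq_cod => c; by rewrite meetx1.
Qed.

(** This trace is among the nowhere dense sublocales that a remote sublocale of the supplement must
    miss. *)
Lemma homogeneous_nowhere_dense_trace (N : sublocale L) :
  homogeneous_maximal_nowhere_dense (supplement S) -> nowhere_dense_in N S ->
  nowhere_dense (restrict (supplement S) (closure N)).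
Proof.
have [a SE] := S_open; have ME := supplement_open SE.
have linfM : linf (supplement S) = a by rewrite ME linf_closed_sub.
move=> [_ _ hom] /nowhere_dense_in_linf[NS].
rewrite (dense_linf S_dense); set n := linf N => n0.
have an : imp a n = n.
  by have := NS _ (linf_in N); rewrite -/n SE => -[y _ <-]; rewrite impA meetxx.
suff na : imp n a = a.
  apply/nowhere_dense_restrict; rewrite linfM.
  have -> : supplement S `&` closure N = closed_sub (Order.join a n).
    rewrite ME; apply/seteqP; split=> x /=; rewrite leUx.
      by move=> [-> ->].
    by move=> /andP.
  (* If c meets the join of a and n below a, then c <= n -> a = a. *)
  rewrite linf_closed_sub; apply: imp_eq_cod => c h.
  rewrite -na le_imp; apply: le_trans h.
  by apply: leI2 => //; exact: leUr.
set b := imp n a; set r := imp b a.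
have Mb : supplement S b by rewrite ME; exact: le_imp_self.
pose R := closure (open_sub (to_sub Mb)).
apply: contrapT => ba.
(* In the locale [supplement S] the bottom is a, so the pseudocomplement of b there is b -> a =
   r. *)
have linfR : linf (embed R) = r.
  have rE : incl (linf (open_sub (to_sub Mb))) = r.
    by rewrite linf_open_sub incl_imp incl_bot linfM.
  apply: linf_min; first by rewrite -rE; eexists; [|reflexivity]; exact: lexx.
  by move=> _ [u Ru <-]; rewrite -rE le_incl.
have ar : a <= r by exact: le_imp_self.
have nr : n <= r by rewrite le_imp meetC imp_mp.
case: (hom R).
- by exists (open_sub (to_sub Mb)) => //; exists (to_sub Mb).
(* A void R would give r = 1, that is b <= a, against [ba]. *)
- move=> R1; apply: ba; apply: le_anti; rewrite le_imp_self andbT.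
  apply/imp_eq_top; rewrite -/r -linfR.
  apply: le_anti; rewrite lex1; apply: le_linf => _ [u + <-].
  by rewrite R1 => ->.
- move=> _; apply; exists (closed_sub n); split.
    by apply/nowhere_dense_linf; rewrite linf_closed_sub.
  apply/nowhere_dense_in_linf; rewrite linfR linf_closed_sub; split.
    by move=> x /linf_lb; rewrite linfR; exact: le_trans.
  by apply: le_anti; rewrite le_imp_self -[X in _ <= X]an imp_anti.
Qed.

End OpenDense.

Theorem proposition5p6 (d : Order.disp_t) (L : localeType d) (S : sublocale L)
    (S_neq_L : S <> [set: L] :> set L) (S_open : is_open S)
    (S_dense : is_dense S) :
  (star_remote_from (supplement S) S ->
   maximal_nowhere_dense (supplement S)) /\
  (homogeneous_maximal_nowhere_dense (supplement S) ->
   forall T : sublocale (as_locale (supplement S)),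
     remote T -> star_remote_from (embed T) S).
Proof.
split; first exact: star_remote_supplement_maximal.
move=> hom T remT; split=> [N ndN|_ [u _ <-]]; last exact: incl_in.
have TN := remT _ (homogeneous_nowhere_dense_trace S_open S_dense hom ndN).
apply/seteqP; split=> [_ [[u Tu <-] Nu]|_ ->]; last by split; exact: sub_top.
have : (T `&` restrict (supplement S) (closure N)) u by [].
by rewrite TN => ->.
Qed.
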